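(* Let $\mathcal L$ be a team-semantic extension of first-order logic. (a) If the atomic formulas of $\mathcal L$ are closed under ultraproducts and the logical operations of $\mathcal L$ preserve being closed under ultraproducts, then $\mathcal L$ has a Łoś' Theorem. (b) If the atomic formulas of $\mathcal L$ are strongly closed under ultraproducts and the logical operations of $\mathcal L$ preserve being strongly closed under ultraproducts, then $\mathcal L$ has a strong Łoś' Theorem.
   Context: Teams. For a $\tau$-structure $\mathcal M$ with domain $M$ and a set $D$ of variables (possibly infinite), an assignment of $\mathcal M$ is a map $s\colon D\to M$; a team of $\mathcal M$ with domain $\mathrm{dom}(X)=D$ is a set $X$ of assignments $D\to M$. A logic over team semantics interprets formulas $\phi$ by a relation $\mathcal M\models_X\phi$ between structures with teams and formulas. A team-semantic extension of first-order logic is such a logic whose formulas are built from atomic formulas (first-order atomic and negated atomic formulas, evaluated by requiring that every $s\in X$ satisfies them in the Tarskian sense, and possibly further atoms) by means of logical operations (connectives and quantifiers), each interpreted by an operation on team properties. Team properties. A team property with domain $D$ is a class $\mathcal P$ of pairs $(\mathcal M,X)$, where $\mathcal M$ is a structure and $X$ a team of $\mathcal M$, such that $D\subseteq\mathrm{dom}(X)$ whenever $(\mathcal M,X)\in\mathcal P$, and such that $\mathcal P$ is closed under isomorphism (if $(\mathcal M,X)\in\mathcal P$ and $\pi\colon\mathcal M\to\mathcal N$ is an isomorphism then $(\mathcal N,\{\pi\circ s\mid s\in X\})\in\mathcal P$). $\mathcal P^c$ denotes the complement of $\mathcal P$. A formula $\phi$ of $\mathcal L$ gives rise to the team property $\llbracket\phi\rrbracket=\{(\mathcal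 M,X)\mid\mathcal M\models_X\phi\}$, whose domain consists of the free variables of $\phi$; saying that $\phi$ is (strongly) closed under ultraproducts means that $\llbracket\phi\rrbracket$ is. Ultraproducts. Let $I$ be a set, $\mathcal U$ an ultrafilter on $I$, $\mathcal M_i$ ($i\in I$) $\tau$-structures, and $\prod_{i\in I}\mathcal M_i/\mathcal U$ the usual ultraproduct. Given assignments $s_i\colon D\to\mathcal M_i$, $(s_i)_{i\in I}/\mathcal U$ is the assignment of the ultraproduct mapping $x\in D$ to the class $(s_i(x))_{i\in I}/\mathcal U$. Given teams $X_i$ of $\mathcal M_i$ with common domain $D$, the team ultraproduct $\prod_{i\in I}X_i/\mathcal U$ is the set of all assignments $s\colon D\to\prod_{i\in I}\mathcal M_i/\mathcal U$ for which there are $s_i\colon D\to\mathcal M_i$ ($i\in I$) with $s=(s_i)_{i\in I}/\mathcal U$ and $\{i\in I\mid s_i\in X_i\}\in\mathcal U$. Closure. A team property $\mathcal P$ with domain $D$ is closed under ultraproducts if for all sets $I$, structures $\mathcal M_i$, teams $X_i$ of $\mathcal M_i$ with domain $D$ ($i\in I$) and ultrafilters $\mathcal U$ on $I$: $\{i\in I\mid(\mathcal M_i,X_i)\in\mathcal P\}\in\mathcal U$ implies $(\prod_{i}\mathcal M_i/\mathcal U,\prod_{i}X_i/\mathcal U)\in\mathcal P$. It is strongly closed under ultraproducts if both $\mathcal P$ and $\mathcal P^c$ are closed under ultraproducts. An $n$-ary operation $f$ on team properties preserves being (strongly) closed under ultraproducts if $f(\mathcal P_0,\dots,\mathcal P_{n-1})$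 is (strongly) closed under ultraproducts whenever all $\mathcal P_0,\dots,\mathcal P_{n-1}$ are. Łoś' Theorem. $\mathcal L$ has a Łoś' Theorem if: for every set $I$, $\tau$-structures $\mathcal M_i$ and teams $X_i$ of $\mathcal M_i$ with a shared domain $D$ ($i\in I$), and ultrafilter $\mathcal U$ on $I$, writing $\mathcal M=\prod_i\mathcal M_i/\mathcal U$ and $X=\prod_iX_i/\mathcal U$, for every $\tau$-formula $\phi$ of $\mathcal L$ whose free variables are contained in $D$, $$\{i\in I\mid\mathcal M_i\models_{X_i}\phi\}\in\mathcal U\implies\mathcal M\models_X\phi.$$ $\mathcal L$ has a strong Łoś' Theorem if the same holds with $\iff$ in place of $\implies$.
   Formalization: Closure under ultraproducts of a team property with domain D is required for teams of every shared domain containing D, not only of domain exactly D; with exact domains the claim fails for non-local atoms. *)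

(* Defs.v *)
From HB Require Import structures.
From mathcomp Require Import all_boot.
From mathcomp Require Import boolp classical_sets filter.

Set Implicit Arguments.
Unset Strict Implicit.
Unset Printing Implicit Defensive.

Local Open Scope classical_set_scope.
Local Open Scope quotient_scope.

(* Constant symbols are function symbols of arity 0. *)
Record signature := Signature {
  fsym : Type;
  far : fsym -> nat;
  rsym : Type;
  rar : rsym -> nat }.

Record structure (tau : signature) := Structure {
  carrier :> Type;
  carrier_inhabited : inhabited carrier;
  fun_interp : forall f : fsym tau, ('I_(far f) -> carrier) -> carrier;
  rel_interp : forall r : rsym tau, ('I_(rar r) -> carrier) -> Prop }.

Record isomorphism (tau : signature) (M N : structure tau) := Isomorphism {
  iso_fun :> M -> N;
  iso_bij : bijective iso_fun;
  iso_fsym : forall (f : fsym tau) (a : 'I_(far f) -> M),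
    iso_fun (fun_interp a) = fun_interp (iso_fun \o a);
  iso_rsym : forall (r : rsym tau) (a : 'I_(rar r) -> M),
    rel_interp a <-> rel_interp (iso_fun \o a) }.

Section Ultraproduct.
Variables (tau : signature) (I : Type) (U : set_system I).
Context {FU : Filter U}.
Variable M : I -> structure tau.

Definition ultra_eq : rel {classic (forall i, M i)} :=
  fun g h => `[< U [set i | g i = h i] >].

Lemma ultra_eq_equiv : equiv_class_of ultra_eq.
Proof.
split=> [g|g h|h g k].
- by apply/asboolP; apply: filterS filterT => i _.
- by apply/idP/idP => /asboolP gh; apply/asboolP; apply: filterS gh.
- move=> /asboolP gh /asboolP hk; apply/asboolP.
  by apply: filterS2 gh hk => i /= ->.
Qed.

Canonical ultra_eq_equiv_rel := EquivRelPack ultra_eq_equiv.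

Definition ultraproduct_carrier := {eq_quot ultra_eq}.

Definition ultra_class (g : forall i, M i) : ultraproduct_carrier :=
  \pi_ultraproduct_carrier (g : {classic (forall i, M i)}).

Definition ultra_repr (x : ultraproduct_carrier) : forall i, M i :=
  (repr x : {classic (forall i, M i)}).

Lemma ultra_classP (g h : forall i, M i) :
  ultra_class g = ultra_class h <-> U [set i | g i = h i].
Proof. by split=> [/eqmodP/asboolP|gh] //; apply/eqmodP/asboolP. Qed.

Lemma ultra_reprK x : ultra_class (ultra_repr x) = x.
Proof. exact: reprK. Qed.

Lemma ultraproduct_inhabited : inhabited ultraproduct_carrier.
Proof.
have ex i : exists x : M i, True.
  by case: (carrier_inhabited (M i)) => x; exists x.
exact: inhabits (ultra_class (fun i => projT1 (cid (ex i)))).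
Qed.

Definition ultraproduct : structure tau := {|
  carrier := ultraproduct_carrier;
  carrier_inhabited := ultraproduct_inhabited;
  fun_interp := fun f a =>
    ultra_class (fun i => fun_interp (fun k => ultra_repr (a k) i));
  rel_interp := fun r a =>
    U [set i | rel_interp (fun k => ultra_repr (a k) i)] |}.

(* The interpretations do not depend on the representatives. *)
Lemma ultra_repr_args n (a : 'I_n -> forall i, M i) :
  U [set i | (fun k => ultra_repr (ultra_class (a k)) i) = (a ^~ i)].
Proof.
have aE k : U [set i | ultra_repr (ultra_class (a k)) i = a k i].
  by apply/ultra_classP; rewrite ultra_reprK.
by apply: filterS (filter_forall _ aE) => i ai; apply/funext.
Qed.

Lemma ultraproduct_fun (f : fsym tau) (a : 'I_(far f) -> forall i, M i) :
  fun_interp (s := ultraproduct) (fun k => ultra_class (a k)) =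
  ultra_class (fun i => fun_interp (a ^~ i)).
Proof.
by apply/ultra_classP; apply: filterS (ultra_repr_args a) => i /= ->.
Qed.

Lemma ultraproduct_rel (r : rsym tau) (a : 'I_(rar r) -> forall i, M i) :
  rel_interp (s := ultraproduct) (fun k => ultra_class (a k)) <->
  U [set i | rel_interp (a ^~ i)].
Proof.
by split=> /= H; apply: filterS2 (ultra_repr_args a) H => i /= ->.
Qed.

End Ultraproduct.

Arguments ultra_class {tau I} U {FU M} g.
Arguments ultraproduct {tau I} U {FU} M.

Section Teams.
Variables (tau : signature) (V : Type).

Definition assignment (D : set V) (M : Type) := D -> M.
Definition team (D : set V) (M : Type) := set (assignment D M).

Definition team_image (D : set V) (M N : Type) (h : M -> N) (X : team D M) :
  team D N := [set (h \o s : assignment D N) | s in X].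

Section UltraproductTeam.
Variables (I : Type) (U : set_system I).
Context {FU : Filter U}.
Variables (M : I -> structure tau) (D : set V).

Definition ultra_assignment (s : forall i, assignment D (M i)) :
  assignment D (ultraproduct U M) := fun x => ultra_class U (fun i => s i x).

Definition ultra_team (X : forall i, team D (M i)) :
  team D (ultraproduct U M) :=
  [set t | exists2 s : forall i, assignment D (M i),
     t = ultra_assignment s & U [set i | X i (s i)]].

End UltraproductTeam.
Arguments ultra_team {I} U {FU M D} X.

Record team_property := TeamProperty {
  tp_dom : set V;
  tp_holds :> forall (M : structure tau) (D : set V), team D M -> Prop;
  tp_sub : forall (M : structure tau) (D : set V) (X : team D M),
    tp_holds X -> tp_dom `<=` D;
  tp_iso : forall (M N : structure tau) (h : isomorphism M N) (D : set V)
    (X : team D M), tp_holds X -> tp_holds (team_image h X) }.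

(* The complement is taken among the teams whose domain contains that of P,
   so that it is again a team property with the same domain. *)
Definition compl_holds (P : team_property) (M : structure tau) (D : set V)
  (X : team D M) := tp_dom P `<=` D /\ ~ P M D X.

Lemma isomorphism_inv (M N : structure tau) (h : isomorphism M N) :
  exists2 g : isomorphism N M, cancel h g & cancel g h.
Proof.
case: h => h [g hK gK] hf hr /=.
have hgE n (a : 'I_n -> N) : h \o (g \o a) = a by apply/funext => k /=.
have gf (f : fsym tau) (a : 'I_(far f) -> N) :
    g (fun_interp a) = fun_interp (g \o a).
  by rewrite -{1}(hgE _ a) -hf hK.
have gr (r : rsym tau) (a : 'I_(rar r) -> N) :
    rel_interp a <-> rel_interp (g \o a).
  by rewrite -{1}(hgE _ a); exact: iff_sym.
by exists (Isomorphism (Bijective gK hK) gf gr).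
Qed.

Lemma compl_sub (P : team_property) (M : structure tau) (D : set V)
  (X : team D M) : compl_holds P X -> tp_dom P `<=` D.
Proof. by case. Qed.

Lemma compl_iso (P : team_property) (M N : structure tau)
  (h : isomorphism M N) (D : set V) (X : team D M) :
  compl_holds P X -> compl_holds P (team_image h X).
Proof.
move=> [PD nPX]; split=> // /(tp_iso _) H; apply: nPX.
have [g hK gK] := isomorphism_inv h.
suff <- : team_image g (team_image h X) = X by exact: H.
have ghE (s : assignment D M) : g \o (h \o s) = s by apply/funext => x /=.
apply/seteqP; split=> [_ [_ [s Xs <-] <-]|s Xs]; first by rewrite ghE.
by exists (h \o s); [exists s|exact: ghE].
Qed.

Definition compl (P : team_property) : team_property :=
  TeamProperty (@compl_sub P) (@compl_iso P).

Definition closed_on (P : team_property) (D : set V) :=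
  forall (I : Type) (U : set_system I) (UU : UltraFilter U)
    (M : I -> structure tau) (X : forall i, team D (M i)),
  U [set i | P (M i) D (X i)] -> P (ultraproduct U M) D (ultra_team U X).

(* The common domain D of the teams ranges over the sets of variables that
   contain the domain of P, since P speaks about teams on all such D. *)
Definition closed_under_ultraproducts (P : team_property) :=
  forall D : set V, tp_dom P `<=` D -> closed_on P D.

Definition strongly_closed_under_ultraproducts (P : team_property) :=
  closed_under_ultraproducts P /\ closed_under_ultraproducts (compl P).

(* op_dom computes the free variables of a compound formula from those of its
   immediate subformulas, e.g. the union for a binary connective, and
   D |-> D `\ x for a quantifier binding x. *)
Record operation := Operation {
  op_arity : nat;
  op_fun :> ('I_op_arity -> team_property) -> team_property;
  op_dom : ('I_op_arity -> set V) -> set V;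
  op_domE : forall P : 'I_op_arity -> team_property,
    tp_dom (op_fun P) = op_dom (fun i => tp_dom (P i)) }.

Definition preserves (C : team_property -> Prop) (f : operation) :=
  forall P : 'I_(op_arity f) -> team_property,
    (forall i, C (P i)) -> C (f P).

Inductive term :=
| Var of V
| App (f : fsym tau) of ('I_(far f) -> term).

Inductive fo_atom :=
| Equal of term & term
| Rel (r : rsym tau) of ('I_(rar r) -> term).

Inductive literal := Pos of fo_atom | Neg of fo_atom.

Fixpoint term_fv (t : term) : set V :=
  match t with
  | Var x => [set x]
  | App f a => \bigcup_i term_fv (a i)
  end.

Definition atom_fv (a : fo_atom) : set V :=
  match a with
  | Equal t u => term_fv t `|` term_fv u
  | Rel r a => \bigcup_i term_fv (a i)
  end.

Definition literal_fv (l : literal) : set V :=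
  match l with Pos a => atom_fv a | Neg a => atom_fv a end.

Section Tarski.
Variables (M : structure tau) (D : set V) (s : assignment D M).

Fixpoint term_eval (t : term) : term_fv t `<=` D -> M :=
  match t with
  | Var x => fun tD => s (exist _ x (mem_set (tD x erefl)))
  | App f a => fun tD => fun_interp (fun i =>
      term_eval (subset_trans (bigcup_sup (i := i) I) tD))
  end.

Definition atom_sat (a : fo_atom) : atom_fv a `<=` D -> Prop :=
  match a with
  | Equal t u => fun aD =>
      term_eval (subset_trans (@subsetUl _ _ _) aD) =
      term_eval (subset_trans (@subsetUr _ _ _) aD)
  | Rel r a => fun aD => rel_interp (fun i =>
      term_eval (subset_trans (bigcup_sup (i := i) I) aD))
  end.

Definition literal_sat (l : literal) : literal_fv l `<=` D -> Prop :=
  match l with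
  | Pos a => fun lD => atom_sat lD
  | Neg a => fun lD => ~ atom_sat lD
  end.

End Tarski.

Definition literal_holds (l : literal) (M : structure tau) (D : set V)
  (X : team D M) :=
  exists lD : literal_fv l `<=` D, forall s, X s -> literal_sat s lD.

Lemma literal_sub (l : literal) (M : structure tau) (D : set V)
  (X : team D M) : literal_holds l X -> literal_fv l `<=` D.
Proof. by case. Qed.

Lemma term_eval_iso (M N : structure tau) (h : isomorphism M N) (D : set V)
  (s : assignment D M) (t : term) (tD : term_fv t `<=` D) :
  term_eval (h \o s : assignment D N) tD = h (term_eval s tD).
Proof.
elim: t tD => [//|f a IH] tD /=.
by rewrite iso_fsym; congr fun_interp; apply/funext => i; rewrite IH.
Qed.

Lemma atom_sat_iso (M N : structure tau) (h : isomorphism M N) (D : set V)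
  (s : assignment D M) (a : fo_atom) (aD : atom_fv a `<=` D) :
  atom_sat (h \o s : assignment D N) aD <-> atom_sat s aD.
Proof.
case: a aD => [t u|r a] aD /=.
  rewrite !term_eval_iso; split=> [|->] //.
  exact: (bij_inj (iso_bij h)).
rewrite (iso_rsym h); set b := fun i => _; set c := (_ \o _).
suff -> : b = c by [].
by apply/funext => i; rewrite /b /c /= term_eval_iso.
Qed.

Lemma literal_iso (l : literal) (M N : structure tau) (h : isomorphism M N)
  (D : set V) (X : team D M) :
  literal_holds l X -> literal_holds l (team_image h X).
Proof.
move=> [lD lX]; exists lD => _ [s Xs <-]; move: (lX s Xs).
by case: l lD {lX} => a aD /=; rewrite atom_sat_iso.
Qed.

Definition literal_property (l : literal) : team_property :=
  TeamProperty (@literal_sub l) (@literal_iso l).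

(* A team-semantic extension of first-order logic: any further atoms, and any
   family of logical operations, each interpreted on team properties. *)
Record team_logic := TeamLogic {
  extra_atom : Type;
  extra_interp : extra_atom -> team_property;
  logical_op : Type;
  logical_op_interp : logical_op -> operation }.

Variable L : team_logic.

Inductive atomic_formula :=
| Literal of literal
| Extra of extra_atom L.

Inductive formula :=
| Atomic of atomic_formula
| Compound (o : logical_op L) of
    ('I_(op_arity (logical_op_interp o)) -> formula).

Definition atomic_fv (a : atomic_formula) : set V :=
  match a with
  | Literal l => literal_fv l
  | Extra e => tp_dom (extra_interp e)
  end.

Fixpoint fv (phi : formula) : set V :=
  match phi with
  | Atomic a => atomic_fv a
  | Compound o args => op_dom (fun i => fv (args i))
  end.

Definition atomic_interp (a : atomic_formula) : team_property :=
  match a with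
  | Literal l => literal_property l
  | Extra e => extra_interp e
  end.

Fixpoint interp (phi : formula) : team_property :=
  match phi with
  | Atomic a => atomic_interp a
  | Compound o args => logical_op_interp o (fun i => interp (args i))
  end.

Lemma interp_dom (phi : formula) : tp_dom (interp phi) = fv phi.
Proof.
elim: phi => [[]|o args IH] //=.
by rewrite op_domE; congr op_dom; apply/funext => i; exact: IH.
Qed.

Definition satisfies (M : structure tau) (D : set V) (X : team D M)
  (phi : formula) : Prop := interp phi M D X.

Definition has_Los_theorem :=
  forall (I : Type) (U : set_system I) (UU : UltraFilter U)
    (M : I -> structure tau) (D : set V) (X : forall i, team D (M i))
    (phi : formula), fv phi `<=` D ->
  U [set i | satisfies (X i) phi] -> satisfies (ultra_team U X) phi.

Definition has_strong_Los_theorem :=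
  forall (I : Type) (U : set_system I) (UU : UltraFilter U)
    (M : I -> structure tau) (D : set V) (X : forall i, team D (M i))
    (phi : formula), fv phi `<=` D ->
  U [set i | satisfies (X i) phi] <-> satisfies (ultra_team U X) phi.

End Teams.

(* Main.v *)
Require Import Defs.
From mathcomp Require Import all_boot.
From mathcomp Require Import boolp classical_sets filter.

Local Open Scope classical_set_scope.

(** A Łoś theorem for [L] says no more than that the property defined by every
formula is closed under ultraproducts. Since compound formulas are interpreted
by applying operations to the properties of their immediate subformulas, this
closure passes from atomic formulas to all formulas by induction
([interp_ind]); nothing about ultraproducts enters there. The strong version
adds the converse implication, which is where the ultrafilter is used: if a
property does not hold at [U]-almost every index then its complement does, so
closure of the complement refutes the property in the ultraproduct
([strongly_closed_iff]). *)

(** The class [C] of properties stays arbitrary so that the same induction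
serves closure and strong closure; the latter is not obtained by inducting on
the two closures separately, as the operations need only preserve their
conjunction. *)
Lemma interp_ind {tau : signature} {V : Type} {L : team_logic tau V}
    {C : team_property tau V -> Prop} :
  (forall a : atomic_formula L, C (interp (Atomic a))) ->
  (forall o : logical_op L, preserves C (logical_op_interp o)) ->
  forall phi : formula L, C (interp phi).
Proof. by move=> Catom Cop; elim=> [a|o args IH]; [exact: Catom|exact: Cop]. Qed.

Lemma strongly_closed_iff {tau : signature} {V : Type}
    {P : team_property tau V} {D : set V} {I : Type} {U : set_system I}
    {UU : UltraFilter U} {M : I -> structure tau}
    {X : forall i, team D (M i)} :
  strongly_closed_under_ultraproducts P -> tp_dom P `<=` D ->
  U [set i | P (M i) D (X i)] <->
  P (ultraproduct U M) D (ultra_team (U := U) X).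
Proof.
move=> [PC PcC] PD; split=> [|PX]; first exact: PC.
have [//|UnP] := in_ultra_setVsetC [set i | P (M i) D (X i)] UU.
have UcP : U [set i | compl P (M i) D (X i)] by apply: filterS UnP => i nPi.
by have [_ /(_ PX)] := PcC D PD I U UU M X UcP.
Qed.

Theorem proposition3p12 (tau : signature) (V : Type) (L : team_logic tau V) :
  ((forall a : atomic_formula L,
       closed_under_ultraproducts (interp (Atomic a))) ->
   (forall o : logical_op L,
       preserves (@closed_under_ultraproducts tau V) (logical_op_interp o)) ->
   has_Los_theorem L)
  /\
  ((forall a : atomic_formula L,
       strongly_closed_under_ultraproducts (interp (Atomic a))) ->
   (forall o : logical_op L,
       preserves (@strongly_closed_under_ultraproducts tau V)
                 (logical_op_interp o)) ->
   has_strong_Los_theorem L).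
Proof.
split=> Catom Cop I U UU M D X phi; rewrite -interp_dom => phiD.
  have closed := interp_ind Catom Cop phi.
  exact: closed D phiD I U UU M X.
exact: strongly_closed_iff (interp_ind Catom Cop phi) phiD.
Qed.
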